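(* Let $X$ be a compact metrizable space and let $f:X\to X$ be a positively expansive continuous map. Then $\mathrm{HausLip}(X,f)=h(f)$, where $h(f)$ is the topological entropy of $f$. In other words, for every $\epsilon>0$ there is a metric $d$ on $X$ compatible with its topology such that $$\mathrm{HD}_d(X)\cdot\log^+\mathrm{Lip}_d(f) < h(f)+\epsilon.$$
   Context: Let $X$ be a compact metrizable space and $f:X\to X$ a continuous map. A metric $d:X\times X\to[0,\infty)$ is compatible if the topology it induces coincides with the topology of $X$; $\mathcal{D}(X)$ denotes the set of all compatible metrics on $X$. For $d\in\mathcal{D}(X)$, the Lipschitz constant is $\mathrm{Lip}_d(f)=\sup_{0<d(x,y)} \frac{d(f(x),f(y))}{d(x,y)}\in[0,\infty]$ (supremum taken in $[0,\infty]$; the value $\infty$ means $f$ is not Lipschitz with respect to $d$). $\mathrm{HD}_d(X)\in[0,\infty]$ is the usual Hausdorff dimension of the metric space $(X,d)$. We write $\log^+(y)=\max(\log y,0)$, with $\log^+ 0=0$ and $\log^+\infty=\infty$. The HausLip constant of the system $(X,f)$ is $$\mathrm{HausLip}(X,f)=\inf_{d\in\mathcal{D}(X)} \mathrm{HD}_d(X)\cdot\log^+\mathrm{Lip}_d(f)\in[0,\infty],$$ with the convention $0\cdot\infty=\infty\cdot 0=\infty$ (so metrics for which $f$ is not Lipschitz or $X$ has infinite Hausdorff dimension are effectively ignored). A continuous map $f:X\to X$ of a compact metric space $(X,d)$ is called positively expansive if there is $c>0$ (an expansivity constant) such that if $d(f^n(x),f^n(y))\leq c$ for all $n\geq0$,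 then $x=y$. This property does not depend on the choice of the compatible metric $d$ (although the constant $c$ may). *)

(* Defs.v *)
From mathcomp Require Import all_boot all_order all_algebra.
From mathcomp Require Import all_classical all_reals all_analysis.

Set Implicit Arguments.
Unset Strict Implicit.
Unset Printing Implicit Defensive.

Import Order.TTheory GRing.Theory Num.Theory.
Import numFieldNormedType.Exports.

Local Open Scope classical_set_scope.
Local Open Scope ring_scope.

Record is_metric (R : realType) (X : Type) (d : X -> X -> R) : Prop := IsMetric {
  metric_ge0 : forall x y, 0 <= d x y ;
  metric_eq0 : forall x y, d x y = 0 <-> x = y ;
  metric_symm : forall x y, d x y = d y x ;
  metric_trian : forall x y z, d x z <= d x y + d y z }.

Definition compatible_metric (R : realType) (X : topologicalType)
    (d : X -> X -> R) : Prop :=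
  is_metric d /\
  forall A : set X, open A <->
    (forall x, A x -> exists2 r, 0 < r & [set y | d x y < r] `<=` A).

Definition metrizable (R : realType) (X : topologicalType) : Prop :=
  exists d : X -> X -> R, compatible_metric d.

Definition expansive_wrt (R : realType) (X : Type) (d : X -> X -> R)
    (f : X -> X) : Prop :=
  exists2 c : R, 0 < c &
    forall x y, (forall n, d (iter n f x) (iter n f y) <= c) -> x = y.

(* On a compact space expansivity does not depend on the compatible metric. *)
Definition positively_expansive (R : realType) (X : topologicalType)
    (f : X -> X) : Prop :=
  exists2 d : X -> X -> R, compatible_metric d & expansive_wrt d f.

Local Open Scope ereal_scope.

(* The explicit 0 makes the supremum one in [0, +oo] when X has at most one
   point. *)
Definition Lip (R : realType) (X : Type) (d : X -> X -> R) (f : X -> X)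
    : \bar R :=
  ereal_sup ([set 0] `|`
    [set (d (f p.1) (f p.2) / d p.1 p.2)%:E
      | p in [set p : X * X | (0 < d p.1 p.2)%R]]).

(* lne 0 = -oo, so log^+ 0 = 0; lne +oo = +oo. *)
Definition logp (R : realType) (y : \bar R) : \bar R := maxe (lne y) 0.

Definition diam (R : realType) (X : Type) (d : X -> X -> R) (A : set X)
    : \bar R :=
  ereal_sup [set (d x y)%:E | x in A & y in A].

(* A singleton contributes 0 `^ 0 = 1 when s = 0; the empty set contributes 0
   for every s, so finite covers may be padded by empty sets. *)
Definition diam_pow (R : realType) (X : Type) (d : X -> X -> R) (s : R)
    (A : set X) : \bar R :=
  if A == set0 then 0 else diam d A `^ s.

Definition hausdorff_pre (R : realType) (X : Type) (d : X -> X -> R)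
    (s delta : R) : \bar R :=
  ereal_inf [set \sum_(i <oo) diam_pow d s (U i)
    | U in [set U : nat -> set X |
        cover setT U = setT /\ forall i, diam d (U i) <= delta%:E]].

(* s-dimensional Hausdorff measure of the whole space *)
Definition hausdorff_measure (R : realType) (X : Type) (d : X -> X -> R)
    (s : R) : \bar R :=
  ereal_sup [set hausdorff_pre d s delta
    | delta in [set delta : R | (0 < delta)%R]].

Definition hausdorff_dim (R : realType) (X : Type) (d : X -> X -> R) : \bar R :=
  ereal_inf [set s%:E
    | s in [set s : R | (0 <= s)%R /\ hausdorff_measure d s = 0]].

(* product on [0, +oo] with the convention 0 * +oo = +oo * 0 = +oo *)
Definition mule_infty (R : realType) (a b : \bar R) : \bar R :=
  if (a == +oo) || (b == +oo) then +oo else a * b.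

Definition HD_logLip (R : realType) (X : Type) (d : X -> X -> R) (f : X -> X)
    : \bar R :=
  mule_infty (hausdorff_dim d) (logp (Lip d f)).

Definition HausLip (R : realType) (X : topologicalType) (f : X -> X) : \bar R :=
  ereal_inf [set HD_logLip d f
    | d in [set d : X -> X -> R | compatible_metric d]].

Definition open_cover (X : topologicalType) (U : set (set X)) : Prop :=
  (forall A, U A -> open A) /\ cover U id = setT.

Definition cover_number (R : realType) (X : Type) (U : set (set X)) : \bar R :=
  ereal_inf [set n%:R%:E
    | n in [set n : nat | exists V : set (set X),
        [/\ V `<=` U, cover V id = setT & (V #= `I_n)%card]]].

(* the join of U, f^-1 U, ..., f^-(n-1) U *)
Definition dyn_join (X : Type) (f : X -> X) (U : set (set X)) (n : nat)
    : set (set X) :=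
  [set \bigcap_(i in `I_n) (iter i f @^-1` A i)
    | A in [set A : nat -> set X | forall i, U (A i)]].

(* The limit exists by subadditivity.  Cover numbers of a nonempty space are at
   least 1, so logp is the logarithm there; on the empty space it gives 0. *)
Definition cover_entropy (R : realType) (X : Type) (f : X -> X)
    (U : set (set X)) : \bar R :=
  limn (fun n : nat => (n%:R^-1)%:E * logp (cover_number R (dyn_join f U n))).

(* Adler-Konheim-McAndrew *)
Definition topological_entropy (R : realType) (X : topologicalType)
    (f : X -> X) : \bar R :=
  ereal_sup [set cover_entropy R f U | U in @open_cover X].

(* Main.v *)
(** Upper bound: for a positively expansive map with expansivity constant [c]
    put [rho x y = a ^ - n], where [n] is the first time at which the orbits of
    [x] and [y] are more than [c] apart.  For [a > 1] close to 1, [rho] is a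
    quasi-metric with constant 2, so by Frink's chain construction it is
    equivalent to a metric [D], which is compatible by expansivity.  The map is
    [a]-Lipschitz for [D], and the elements of the [n]-th join of a cover by
    [d]-small sets have [D]-diameter at most [a ^ - n], so the Hausdorff
    dimension is at most [h / ln a]; the product is at most [h].

    Lower bound: let [f] be [lam]-Lipschitz with [s]-dimensional Hausdorff
    measure 0.  A set of diameter [e] stays small for about
    [t = ln (1 / e) / ln lam] iterates, and [lam `^ (- s * t)] is comparable to
    [e `^ s].  Hence there is a finite cover by sets [O i] with times [t i] such
    that [\sum_i lam `^ (- s * t i) <= 1].  Splitting the itineraries of length
    [n] according to the initial set, their number [N n] satisfies
    [N n <= \sum_i N (n - t i)], whence [N n <= C * lam `^ (s * n)] and the
    entropy is at most [s * ln lam]. *)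
Require Import Defs.
From mathcomp Require Import all_boot all_order all_algebra.
From mathcomp Require Import all_classical all_reals all_analysis.
From mathcomp Require Import ring lra.

Set Implicit Arguments.
Unset Strict Implicit.
Unset Printing Implicit Defensive.

Import Order.TTheory GRing.Theory Num.Theory.
Import numFieldNormedType.Exports.

Local Open Scope classical_set_scope.
Local Open Scope ring_scope.

(** * Itineraries and cover numbers of dynamical joins *)

(* [N] members of the [n]-th dynamical join of [U] cover [X]; a member is given
   by the sequence of sets of [U] that it visits. *)
Definition itinerary_cover (X : Type) (f : X -> X) (U : set (set X))
    (n N : nat) : Prop :=
  exists (I : finType) (B : I -> nat -> set X),
    [/\ #|I| = N, forall j i, U (B j i) &
        forall x, exists j, forall i, (i < n)%N -> B j i (iter i f x)].

Definition shift_concat (T : Type) (k : nat) (u v : nat -> T) (i : nat) : T :=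
  if (i < k)%N then u i else v (i - k)%N.

Section ItineraryCovers.
Context {X : Type} (f : X -> X) (U : set (set X)).

Lemma itinerary_cover0 A : U A -> itinerary_cover f U 0 1.
Proof.
move=> UA; exists unit, (fun _ _ => A); split => [|//|x]; last by exists tt.
exact: card_unit.
Qed.

Lemma itinerary_cover_empty n :
  (forall x : X, False) -> itinerary_cover f U n 0.
Proof.
move=> X0; exists void, (fun _ _ => set0).
by split => [|//|x]; [rewrite card_void | case: (X0 x)].
Qed.

(* Points are sorted by the set [O i] they start in; after time [t i] their
   itineraries continue as those of an arbitrary point. *)
Lemma itinerary_cover_rec (p n : nat) (O : nat -> set X)
    (B : nat -> nat -> set X) (t c : nat -> nat) :
  (forall x, exists2 i, (i < p)%N & O i x) ->
  (forall i j, U (B i j)) ->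
  (forall i j x, O i x -> (j < t i)%N -> B i j (iter j f x)) ->
  (forall i, (i < p)%N -> itinerary_cover f U (n - t i) (c i)) ->
  itinerary_cover f U n (\sum_(i < p) c i).
Proof.
move=> Ocov UB OB covc.
have /choice[J JP] : forall i : 'I_p,
    exists J : {J : finType & J -> nat -> set X},
    [/\ #|tag J| = c i, forall j k, U (tagged J j k) &
    forall x, exists j, forall k, (k < n - t i)%N -> tagged J j k (iter k f x)].
  by move=> i; have [J [D]] := covc i (ltn_ord i); exists (existT _ J D).
exists {i : 'I_p & tag (J i)}, (fun ij : {i : 'I_p & tag (J i)} =>
  shift_concat (t (tag ij)) (B (tag ij)) (tagged (J (tag ij)) (tagged ij))).
split.
- rewrite card_tagged sumnE big_map big_enum /=.
  by apply: eq_bigr => i _; have [] := JP i.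
- move=> [i j] k /=; rewrite /shift_concat; case: ifP => // _.
  by have [_ + _] := JP i; apply.
- move=> x; have [i ip Oix] := Ocov x.
  have [_ _ /(_ (iter (t i) f x))[j jP]] := JP (Ordinal ip).
  exists (existT _ (Ordinal ip) j) => k kn /=; rewrite /shift_concat.
  case: ltnP => kt; first exact: OB.
  have -> : iter k f x = iter (k - t i) f (iter (t i) f x).
    by rewrite -iterD subnK.
  by apply: jP; rewrite ltn_sub2rE.
Qed.

(** Submultiplicativity of the counts: after taking logarithms this is the hypothesis of Fekete's
    lemma. *)
Lemma itinerary_coverD m n M N : itinerary_cover f U m M ->
  itinerary_cover f U n N -> itinerary_cover f U (m + n) (M * N).
Proof.
move=> [I [B [cI UB Bcov]]] [J [D [cJ UD Dcov]]].
exists (I * J)%type, (fun ij => shift_concat m (B ij.1) (D ij.2)); split.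
- by rewrite card_prod cI cJ.
- by move=> [i j] k /=; rewrite /shift_concat; case: ifP.
- move=> x; have [i iP] := Bcov x; have [j jP] := Dcov (iter m f x).
  exists (i, j) => k kn /=; rewrite /shift_concat.
  case: ltnP => km; first exact: iP.
  by rewrite -{2}(subnK km) iterD; apply: jP; rewrite ltn_subLR.
Qed.

Lemma cover_number_le (R : realType) n N : itinerary_cover f U n N ->
  (cover_number R (dyn_join f U n) <= N%:R%:E)%E.
Proof.
move=> [I [B [cI UB Bcov]]].
pose C := fun j : I => \bigcap_(i in `I_n) (iter i f @^-1` B j i).
(* Distinct indices may give the same set, so the family is counted as an image of [I_N]: [g]
   enumerates it along [I], with a default value outside. *)
pose g k := if insub k is Some i then C (enum_val (i : 'I_#|I|)) else set0.
have leN : (range C #<= `I_N)%card.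
  apply: (card_le_trans _ (card_image_le g _)); apply: subset_card_le.
  move=> _ [j _ <-]; exists (enum_rank j); first by rewrite /= -cI ltn_ord.
  by rewrite /g valK enum_rankK.
have [m Cm] : exists m, (range C #= `I_m)%card.
  by apply/finite_setP; exact: card_le_finite leN (finite_II N).
have mN : (m <= N)%N by rewrite -card_le_II -(card_le_eql Cm).
apply: (@le_trans _ _ m%:R%:E); last by rewrite lee_fin ler_nat.
apply: ereal_inf_lbound; exists m => //; exists (range C); split => //.
- by move=> _ [j _ <-]; exists (B j).
- apply/seteqP; split => // x _; have [j jP] := Bcov x.
  by exists (C j) => //; exists j.
Qed.

Lemma cover_number_cover n N V : V `<=` dyn_join f U n -> cover V id = setT ->
  (V #= `I_N)%card -> itinerary_cover f U n N.
Proof.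
move=> VU Vcov; rewrite card_eq_sym => /card_set_bijP[g [gV _ gsurj]].
have /choice[A AP] : forall j : 'I_N, exists A : nat -> set X,
    (forall i, U (A i)) /\ g j = \bigcap_(i in `I_n) (iter i f @^-1` A i).
  move=> j; have [A UA <-] := VU _ (gV j (ltn_ord j)).
  by exists A.
exists 'I_N, A; split; first exact: card_ord.
  by move=> j i; have [] := AP j.
move=> x; have : cover V id x by rewrite Vcov.
move=> [W /gsurj[k kN <-] /= gkx].
exists (Ordinal kN) => i ni; have [_ gE] := AP (Ordinal kN).
by move: gkx; rewrite /= gE; apply.
Qed.

(** The infimum runs over natural numbers, so the least [N] admitting an itinerary cover realises
    it. *)
Lemma cover_number_attained (R : realType) n M : itinerary_cover f U n M ->
  exists2 N, itinerary_cover f U n N &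
    cover_number R (dyn_join f U n) = N%:R%:E.
Proof.
move=> covM; pose P N := `[< itinerary_cover f U n N >].
have exP : exists N, P N by exists M; apply/asboolP.
case: (ex_minnP exP) => N /asboolP covN minN; exists N => //.
apply/eqP; rewrite eq_le cover_number_le //=.
apply: le_ereal_inf_tmp => _ [k [V [VU Vcov Vk]] <-].
rewrite lee_fin ler_nat; apply: minN; apply/asboolP.
exact: cover_number_cover VU Vcov Vk.
Qed.
End ItineraryCovers.

(** * Subadditive sequences and the entropy of a cover as a limit *)

Lemma exprn_unbounded (R : realType) (b C : R) : 1 < b ->
  exists n, C < b ^+ n.
Proof.
move=> b1; have b0 : 0 < b by exact: lt_trans ltr01 b1.
have r0 : 0 < (1 + `|C|)^-1 by rewrite invr_gt0 ltr_pwDl.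
have : b^-1 ^+ n @[n --> \oo] --> 0.
  by apply: cvg_expr; rewrite gtr0_norm ?invr_gt0// invf_lt1.
move=> /cvgr0_norm_lt/(_ _ r0)[n _ /(_ n (leqnn n)) /= bn].
exists n; move: bn; rewrite exprVn gtr0_norm ?invr_gt0 ?exprn_gt0//.
rewrite ltf_pV2 ?posrE ?exprn_gt0 ?ltr_pwDl//; apply: le_lt_trans.
by rewrite (le_trans (ler_norm _))// lerDr.
Qed.

Lemma subadditive_mul (R : realType) (a : nat -> R) (m q r : nat) :
  (forall m n, a (m + n)%N <= a m + a n) -> a (q * m + r)%N <= q%:R * a m + a r.
Proof.
move=> aD; elim: q => [|q IH]; first by rewrite mul0n mul0r add0r.
rewrite mulSn -addnA (le_trans (aD _ _))// -natr1 mulrDl mul1r.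
by rewrite (addrC (_ * _)) -addrA lerD2l.
Qed.

(** Division of [n] by a fixed [m.+1] whose average is nearly the infimum bounds [a n] by a multiple
    of [a m.+1] plus a constant. The infimum starts at index 1, because the term at 0 is
    [0^-1 * a 0 = 0]. *)
Lemma fekete (R : realType) (a : nat -> R) : (forall n, 0 <= a n) ->
  (forall m n, a (m + n)%N <= a m + a n) ->
  n%:R^-1 * a n @[n --> \oo] --> inf (range (fun n => n.+1%:R^-1 * a n.+1)).
Proof.
move=> a0 aD; set l := inf _.
have Elb : has_inf (range (fun n => n.+1%:R^-1 * a n.+1)).
  split; first by exists (1%:R^-1 * a 1%N); exists 0%N.
  by exists 0 => _ [n _ <-]; rewrite mulr_ge0 ?invr_ge0.
apply/cvgrPdist_le => e e0.
have e20 : 0 < e / 2 by rewrite divr_gt0.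
have [_ [m _ <-] am] := inf_adherent e20 Elb; rewrite -/l in am.
(* By nonnegativity, [C] dominates [a r] for every possible remainder [r], independently of [n]. *)
pose C := \sum_(i < m.+1) a i.
near=> n.
have n0 : (0 < n)%N by near: n; exact: nbhs_infty_gt.
have nR0 : 0 < n%:R :> R by rewrite ltr0n.
have ln : l <= n%:R^-1 * a n.
  by apply: ge_inf; [case: Elb | exists n.-1 => //; rewrite prednK].
rewrite distrC ger0_norm ?subr_ge0// lerBlDl.
have anC : a n <= (n %/ m.+1)%:R * a m.+1 + C.
  rewrite {1}(divn_eq n m.+1) (le_trans (subadditive_mul _ _ _ aD))// lerD2l.
  rewrite /C (bigD1 (Ordinal (ltn_pmod n (ltn0Sn m))))//= lerDl.
  exact: sumr_ge0.
have Cn : C <= n%:R * (e / 2).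
  rewrite -ler_pdivrMr//; near: n; exact: nbhs_infty_ger.
have qn : (n %/ m.+1)%:R <= n%:R / m.+1%:R :> R.
  by rewrite ler_pdivlMr ?ltr0n// -natrM ler_nat leq_trunc_div.
rewrite mulrC ler_pdivrMr// (le_trans anC)//.
have -> : (l + e) * n%:R = n%:R * (l + e / 2) + n%:R * (e / 2).
  by field.
apply: lerD => //; apply: (le_trans (ler_wpM2r (a0 _) qn)).
by rewrite -mulrA ler_wpM2l// ltW.
Unshelve. all: by end_near. Qed.

Section CoverEntropy.
Context {R : realType} {X : Type} (f : X -> X) (U : set (set X)).

(** The [maxn 1] accounts for the cover number 0 of the empty space, where [logp] is 0. *)
Lemma logp_nat (n : nat) : logp (n%:R%:E : \bar R) = (ln (maxn 1 n)%:R)%:E.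
Proof.
rewrite /logp /=; case: n => [|n].
  by rewrite lexx ln1 /maxe ltNyr.
rewrite (_ : (maxn _ _) = n.+1)%N; last by apply/maxn_idPr.
by rewrite lern0 /= maxEge lee_fin ln_ge0// ler1n.
Qed.

(** Replaces the extended-real limit by a real [h] and by minimal counts [N n], with which all later
    estimates are made. *)
Lemma cover_entropy_cvg : (exists N, itinerary_cover f U 1 N) ->
  (exists A, U A) ->
  exists N : nat -> nat, exists2 h : R,
    (forall n, itinerary_cover f U n (N n)) &
    [/\ cover_entropy R f U = h%:E,
        n%:R^-1 * ln (maxn 1 (N n))%:R @[n --> \oo] --> h,
        0 <= h &
        forall n M, itinerary_cover f U n M -> (N n <= M)%N].
Proof.
move=> [M1 cov1] [A UA].
have covM n : exists M, itinerary_cover f U n M.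
  elim: n => [|n [M covM]]; first by exists 1%N; exact: itinerary_cover0 UA.
  by exists (M1 * M)%N; rewrite -add1n; exact: itinerary_coverD.
have /choice[N NP] : forall n, exists N, itinerary_cover f U n N /\
    cover_number R (dyn_join f U n) = N%:R%:E.
  move=> n; have [M {}covM] := covM n.
  by have [N ? ?] := cover_number_attained R covM; exists N.
have covN n : itinerary_cover f U n (N n) by have [] := NP n.
have minN n M : itinerary_cover f U n M -> (N n <= M)%N.
  move=> /(cover_number_le R); have [_ ->] := NP n.
  by rewrite lee_fin ler_nat.
pose a n : R := ln (maxn 1 (N n))%:R.
have a0 n : 0 <= a n by rewrite ln_ge0// ler1n leq_maxl.
have aD m n : a (m + n)%N <= a m + a n.
  rewrite /a -lnM ?posrE ?ltr0n ?leq_max// -natrM.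
  rewrite ler_ln ?posrE ?ltr0n ?muln_gt0 ?leq_max//.
  rewrite ler_nat geq_max !muln_gt0 !leq_max /=.
  apply: leq_trans (minN _ _ (itinerary_coverD (covN m) (covN n))) _.
  by rewrite leq_mul ?leq_maxr.
have cvga := fekete a0 aD; set h := inf _ in cvga.
exists N, h => //; split => //.
- rewrite /cover_entropy.
  rewrite (_ : (fun n => _) = EFin \o (fun n => n%:R^-1 * a n)); last first.
    by apply/funext => n /=; rewrite (NP n).2 logp_nat -EFinM.
  by apply/cvg_lim => //; apply: cvg_EFin; [exact: nearW|exact: cvga].
- apply: (cvgr_to_ge cvga); apply: nearW => n.
  by rewrite mulr_ge0 ?invr_ge0.
Qed.
End CoverEntropy.

(** * Compatible metrics on a compact space and uniform expansivity *)

Lemma continuous_iter (X : topologicalType) (f : X -> X) n :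
  continuous f -> continuous (iter n f).
Proof.
move=> cf; elim: n => [|n IH] x /=; first exact: cvg_id.
by apply: continuous_comp; [exact: IH|exact: cf].
Qed.

Section CompatibleMetric.
Context {R : realType} {X : topologicalType} (d : X -> X -> R).
Hypothesis dX : compatible_metric d.

Lemma compatible_xx x : d x x = 0.
Proof. by case: dX => md _; apply/(metric_eq0 md). Qed.

Lemma compatible_near x r : 0 < r -> \forall y \near x, d x y < r.
Proof.
case: dX => md openP r0; apply: (@open_nbhs_nbhs X x [set y | d x y < r]).
split; last by rewrite /= compatible_xx.
apply/openP => y /= xy; exists (r - d x y); first by rewrite subr_gt0.
by move=> z /= yz; rewrite (le_lt_trans (metric_trian md x y z))// -ltrBrDl.
Qed.

Lemma compatible_nbhsP (x : X) (A : set X) :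
  nbhs x A <-> exists2 r, 0 < r & [set y | d x y < r] `<=` A.
Proof.
split=> [|[r r0 rA]]; last first.
  by apply: filterS rA _; exact: compatible_near.
rewrite nbhsE => -[B [oB Bx] BA]; case: dX => _ /(_ B)[/(_ oB x Bx)[r r0 rB] _].
by exists r => //; exact: subset_trans BA.
Qed.

Lemma compatible_nearM (g : X -> X) x r : continuous g -> 0 < r ->
  \forall y \near x, d (g x) (g y) < r.
Proof. by move=> /(_ x) cg r0; exact: (cg _ (compatible_near (g x) r0)). Qed.

(** Makes separation at a given time an open condition on pairs of points. *)
Lemma compatible_near2 (g : X -> X) (x y : X) e : continuous g -> 0 < e ->
  \forall z \near (x, y), `|d (g z.1) (g z.2) - d (g x) (g y)| < e.
Proof.
move=> cg e0; case: dX => md _.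
have e20 : 0 < e / 2 by rewrite divr_gt0.
exists ([set z | d (g x) (g z) < e / 2], [set z | d (g y) (g z) < e / 2]).
  by split; exact: compatible_nearM.
move=> [a b] [/= xa yb].
have := metric_trian md (g x) (g a) (g y).
have := metric_trian md (g a) (g b) (g y).
have := metric_trian md (g a) (g x) (g b).
have := metric_trian md (g x) (g y) (g b).
rewrite (metric_symm md (g b)) (metric_symm md (g a) (g x)) => *.
by rewrite ltr_norml; apply/andP; split; lra.
Qed.

Hypothesis compactX : compact [set: X].

(** Near each point a single member of [U] serves all small radii; compactness, in its near-covering
    form along the filter of radii tending to 0, yields one radius for all points. *)
Lemma lebesgue_number U : open_cover U ->
  exists2 r, 0 < r & forall x, exists2 A, U A & [set y | d x y < r] `<=` A.
Proof.
move=> [oU covU].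
pose P (r : R) x := exists2 A, U A & [set y | d x y < r] `<=` A.
have /compact_near_coveringP/(_ R 0^'+ P) := compactX.
move=> /(_ _)[x _|r /= r0 rP].
  have : cover U id x by rewrite covU.
  move=> [A UA /= Ax].
  have /compatible_nbhsP[r r0 rA] : nbhs x A.
    by apply: open_nbhs_nbhs; split=> //; exact: oU.
  have r20 : 0 < r / 2 by rewrite divr_gt0.
  near=> y s; exists A => // z /= yz; apply: rA => /=.
  case: dX => md _; rewrite (le_lt_trans (metric_trian md x y z))//.
  rewrite (splitr r) ltrD//.
    by near: y; exact: compatible_near.
  by rewrite (lt_trans yz)//; near: s; exact: nbhs_right_lt.
have r20 : 0 < r / 2 by rewrite divr_gt0.
exists (r / 2) => // x; apply: rP => //=.
by rewrite sub0r normrN gtr0_norm// gtr_pMr// invf_lt1// ltr1n.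
Unshelve. all: by end_near. Qed.

Lemma finite_itinerary_cover (f : X -> X) U : open_cover U ->
  exists N, itinerary_cover f U 1 N.
Proof.
move=> [oU covU].
(* The filter generated by the finite subfamilies of [U] under inclusion. *)
pose F : set_system (seq (set X)) := [set S : set (seq (set X)) |
  exists2 s0 : seq (set X), (forall A, A \in s0 -> U A) &
    forall s : seq (set X), {subset s0 <= s} -> S s].
have FF : Filter F.
  split.
  - by exists [::].
  - move=> S T [s sU sS] [t tU tT]; exists (s ++ t) => [A|u stu].
      by rewrite mem_cat => /orP[/sU|/tU].
    split; [apply: sS|apply: tT] => A As; apply: stu.
      by rewrite mem_cat As.
    by rewrite mem_cat As orbT.
  - by move=> S T ST [s sU sS]; exists s => // u /sS /ST.
pose P (s : seq (set X)) x := exists2 A, A \in s & A x.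
have /compact_near_coveringP/(_ _ F P FF) := compactX.
move=> /(_ _)[x _|s sU /(_ s (fun _ => id)) sX].
  have : cover U id x by rewrite covU.
  move=> [A UA /= Ax].
  have /compatible_nbhsP[r r0 rA] : nbhs x A.
    by apply: open_nbhs_nbhs; split=> //; exact: oU.
  exists ([set y | d x y < r], [set s : seq (set X) | A \in s]) => /=.
    split; first exact: compatible_near.
    exists [:: A] => [B|u uA]; first by rewrite inE => /eqP ->.
    by apply: uA; rewrite inE.
  by move=> [y s] [/= xy As]; exists A => //; exact: rA.
exists (size s), 'I_(size s), (fun (j : 'I_(size s)) _ => nth set0 s j); split.
- exact: card_ord.
- by move=> j _; apply/sU/mem_nth.
- move=> x; have [A As Ax] := sX x I.
  have iA : (index A s < size s)%N by rewrite index_mem.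
  by exists (Ordinal iA) => -[|]//= _; rewrite nth_index.
Qed.

(** A pair at distance at least [r] separates beyond [c] at some time, and nearby pairs separate at
    that same time; compactness of the square bounds these times. *)
Lemma expansive_uniform (f : X -> X) (c r : R) : continuous f -> 0 < r ->
  (forall x y, (forall n, d (iter n f x) (iter n f y) <= c) -> x = y) ->
  exists m, forall x y, r <= d x y ->
    exists2 k, (k <= m)%N & c < d (iter k f x) (iter k f y).
Proof.
move=> cf r0 expf; case: (dX) => md _.
(* The first alternative disposes of close pairs, so that compactness applies to the whole
   square. *)
pose P m (z : X * X) := d z.1 z.2 < r \/
  exists2 k, (k <= m)%N & c < d (iter k f z.1) (iter k f z.2).
have := compact_setX compactX compactX; rewrite setXTT.
move=> /compact_near_coveringP/(_ nat \oo P).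
move=> /(_ _)[|m _ mP].
  move=> [x y] _; have [xr|xr] := ltP (d x y) r.
    have e0 : 0 < r - d x y by rewrite subr_gt0.
    near=> z m; left; have : `|d z.1 z.2 - d x y| < r - d x y.
      by near: z; exact: (@compatible_near2 id x y _ (fun=> cvg_id) e0).
    by rewrite ltr_norml => /andP[_]; rewrite ltrD2r.
  have [k kc] : exists k, c < d (iter k f x) (iter k f y).
    apply: contrapT => nk; suff xy : x = y.
      by move: xr; rewrite xy compatible_xx leNgt r0.
    apply: expf => n; rewrite leNgt; apply/negP => nc.
    by apply: nk; exists n.
  have e0 : 0 < d (iter k f x) (iter k f y) - c by rewrite subr_gt0.
  near=> z m; right; exists k => /=.
    by near: m; exact: nbhs_infty_ge.
  have : `|d (iter k f z.1) (iter k f z.2) - d (iter k f x) (iter k f y)| <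
      d (iter k f x) (iter k f y) - c.
    by near: z; exact: (compatible_near2 x y (continuous_iter cf) e0).
  by rewrite ltr_norml => /andP[+ _]; rewrite opprB ltrD2r.
exists m => x y rxy; have [|//] := mP m (leqnn m) (x, y) I.
by rewrite /= ltNge rxy.
Unshelve. all: by end_near. Qed.

End CompatibleMetric.

(** * Frink's chain construction *)

Section ChainMetric.
Context {R : realType} {X : Type} (rho : X -> X -> R).
Implicit Types (x y z : X) (s : seq X).

Fixpoint chain_length x s : R :=
  if s is y :: s' then rho x y + chain_length y s' else 0.

Definition chain_metric x y : R :=
  inf [set chain_length x s | s in [set s | last x s = y]].

Hypothesis rho_ge0 : forall x y, 0 <= rho x y.

Lemma chain_length_ge0 x s : 0 <= chain_length x s.
Proof. by elim: s x => //= y s IH x; rewrite addr_ge0. Qed.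

Lemma chain_length_cat x s t :
  chain_length x (s ++ t) = chain_length x s + chain_length (last x s) t.
Proof. by elim: s x => [x|y s IH x] /=; rewrite ?add0r// IH addrA. Qed.

Lemma chain_metric_lbound x s : chain_metric x (last x s) <= chain_length x s.
Proof.
apply: ge_inf; last by exists s.
by exists 0 => _ [t _ <-]; exact: chain_length_ge0.
Qed.

Lemma le_chain_metric x y t :
  (forall s, last x s = y -> t <= chain_length x s) -> t <= chain_metric x y.
Proof.
move=> ts; apply: lb_le_inf.
  by exists (chain_length x [:: y]); exists [:: y].
by move=> _ [s /= sy <-]; exact: ts.
Qed.

Lemma chain_metric_ge0 x y : 0 <= chain_metric x y.
Proof. by apply: le_chain_metric => s _; exact: chain_length_ge0. Qed.

Lemma chain_metric_le x y : chain_metric x y <= rho x y.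
Proof. by have := chain_metric_lbound x [:: y]; rewrite /= addr0. Qed.

Lemma chain_metric_trian x y z :
  chain_metric x z <= chain_metric x y + chain_metric y z.
Proof.
rewrite -lerBlDr; apply: le_chain_metric => s sy.
rewrite lerBlDr addrC -lerBlDr; apply: le_chain_metric => t tz.
rewrite lerBlDr addrC -{1}sy -chain_length_cat -tz -sy -last_cat.
exact: chain_metric_lbound.
Qed.

(** The image of a chain under [f] is a chain at most [a] times as long. *)
Lemma chain_metric_homo (f : X -> X) (a : R) : 0 <= a ->
  (forall x y, rho (f x) (f y) <= a * rho x y) ->
  forall x y, chain_metric (f x) (f y) <= a * chain_metric x y.
Proof.
move=> a0 fa x y.
have fs s : forall x, chain_length (f x) (map f s) <= a * chain_length x s.
  elim: s => [|z s IH] u /=; first by rewrite mulr0.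
  by rewrite mulrDr lerD.
move: a0; rewrite le_eqVlt => /predU1P[a0|a0].
  by have := fs [:: y] x; rewrite -a0 !mul0r; apply: le_trans;
    have := chain_metric_lbound (f x) [:: f y].
rewrite mulrC -ler_pdivrMr//; apply: le_chain_metric => s sy.
rewrite ler_pdivrMr// mulrC; apply: le_trans (fs s x).
by rewrite -sy -last_map; exact: chain_metric_lbound.
Qed.

Hypothesis rho_sym : forall x y, rho x y = rho y x.

Lemma chain_metric_sym x y : chain_metric x y = chain_metric y x.
Proof.
have rev s : forall x, exists2 t, last (last x s) t = x &
    chain_length (last x s) t = chain_length x s.
  elim: s => [|z s IH] u /=; first by exists [::].
  have [t tz tE] := IH z; exists (t ++ [:: u]); first by rewrite last_cat.
  by rewrite chain_length_cat tz tE /= addr0 addrC rho_sym.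
suff le u v : chain_metric u v <= chain_metric v u.
  by apply/eqP; rewrite eq_le !le.
apply: le_chain_metric => s <-; have [t tv <-] := rev s v.
by rewrite -{2}tv; exact: chain_metric_lbound.
Qed.

Hypothesis rho_xx : forall x, rho x x = 0.

(** The link arriving at [z] is the one along which the running length reaches [t]. *)
Lemma chain_split x s t : s <> [::] -> 0 <= t -> t <= chain_length x s ->
  exists s1 z s2, [/\ s = s1 ++ z :: s2, chain_length x s1 <= t &
    chain_length z s2 <= chain_length x s - t].
Proof.
elim: s x t => [//|y s IH] x t _ t0 /= ts.
have [txy|xyt] := leP t (rho x y).
  by exists [::], y, s; split => //=; rewrite lerBrDl lerD2r.
have s0 : s <> [::].
  by move=> s0; move: ts; rewrite s0 /= addr0 leNgt xyt.
have [||s1 [z [s2 [-> s1t s2t]]]] := IH y (t - rho x y) s0.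
- by rewrite subr_ge0 ltW.
- by rewrite lerBlDl.
exists (y :: s1), z, s2; split => //=; first by rewrite -lerBrDl.
by rewrite (le_trans s2t)// opprB addrA [_ + rho x y]addrC.
Qed.

(* Cutting a chain of length [l] at its midpoint leaves one link and two chains
   of length at most [l / 2]. *)
Lemma frink (rho_trian : forall x y z w,
    rho x w <= 2 * Num.max (rho x y) (Num.max (rho y z) (rho z w))) x s :
  rho x (last x s) <= 2 * chain_length x s.
Proof.
have [n] := ubnP (size s); elim: n => // n IH in x s *; rewrite ltnS => sn.
have [->|s0] := pselect (s = [::]); first by rewrite /= rho_xx mulr0.
have l0 := chain_length_ge0 x s.
have [||s1 [z [s2 [sE s1l s2l]]]] := @chain_split x s (chain_length x s / 2) s0.
- by rewrite divr_ge0.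
- by rewrite ler_pdivrMr// ler_peMr// ler1n.
have sizes : (size s = (size s1 + size s2).+1)%N by rewrite sE size_cat addnS.
have s1n : (size s1 < n)%N by rewrite (leq_trans _ sn)// sizes ltnS leq_addr.
have s2n : (size s2 < n)%N by rewrite (leq_trans _ sn)// sizes ltnS leq_addl.
have rho1 := IH x s1 s1n; have rho2 := IH z s2 s2n.
have rhoz : rho (last x s1) z <= chain_length x s.
  rewrite sE chain_length_cat /= addrA -addrA addrCA lerDl.
  by rewrite addr_ge0 ?chain_length_ge0.
(* Each of the three terms is at most the length of the chain: the outer ones by induction, as twice
   one half of it, and the middle one as a single link. *)
rewrite {1}sE last_cat /= (le_trans (rho_trian _ (last x s1) z _))//.
rewrite ler_wpM2l// !ge_max rhoz /=; apply/andP; split; lra.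
Qed.

Lemma le_frink (rho_trian : forall x y z w,
    rho x w <= 2 * Num.max (rho x y) (Num.max (rho y z) (rho z w))) x y :
  rho x y <= 2 * chain_metric x y.
Proof.
rewrite mulrC -ler_pdivrMr//; apply: le_chain_metric => s <-.
by rewrite ler_pdivrMr// mulrC; exact: frink.
Qed.

End ChainMetric.

(** * The quasi-metric of separation times and the expansive metric *)

Section ExpansionGauge.
Context {R : realType} {X : Type} (d : X -> X -> R) (f : X -> X) (c a : R).
Hypothesis a1 : 1 < a.

(** For [a > 1] the supremum is attained at the first separation time; the explicit 0 is the value
    for orbits that never separate. *)
Definition expansion_gauge x y : R :=
  sup ([set 0] `|`
    [set a ^- n | n in [set n | c < d (iter n f x) (iter n f y)]]).

Let a0 : 0 < a. Proof. exact: lt_trans ltr01 a1. Qed.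

Lemma expansion_gauge_ge n x y : c < d (iter n f x) (iter n f y) ->
  a ^- n <= expansion_gauge x y.
Proof.
move=> cn; apply: ub_le_sup; last by right; exists n.
exists 1 => _ [->|[k _ <-]] //.
by rewrite invf_le1 ?exprn_gt0// exprn_ege1// ltW.
Qed.

Lemma expansion_gauge_le x y t : 0 <= t ->
  (forall n, c < d (iter n f x) (iter n f y) -> a ^- n <= t) ->
  expansion_gauge x y <= t.
Proof.
move=> t0 tn; apply: ge_sup; first by exists 0; left.
by move=> _ [->|[k ck <-]] //; exact: tn.
Qed.

Lemma expansion_gauge_ge0 x y : 0 <= expansion_gauge x y.
Proof.
apply: ub_le_sup; last by left.
exists 1 => _ [->|[k _ <-]] //.
by rewrite invf_le1 ?exprn_gt0// exprn_ege1// ltW.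
Qed.

(** A separation of [f x] and [f y] at time [n] is one of [x] and [y] at time [n.+1]. *)
Lemma expansion_gauge_homo x y :
  expansion_gauge (f x) (f y) <= a * expansion_gauge x y.
Proof.
apply: expansion_gauge_le; first by rewrite mulr_ge0 ?expansion_gauge_ge0// ltW.
move=> n; rewrite -!iterSr => cn; rewrite -ler_pdivrMl//.
by rewrite -invfM -exprS; exact: expansion_gauge_ge.
Qed.

Lemma expansion_gauge_bowen n x y :
  (forall i, (i < n)%N -> d (iter i f x) (iter i f y) <= c) ->
  expansion_gauge x y <= a ^- n.
Proof.
move=> dn; apply: expansion_gauge_le => [|k ck].
  by rewrite invr_ge0 exprn_ge0// ltW.
have nk : (n <= k)%N by rewrite leqNgt; apply/negP => /dn; rewrite leNgt ck.
by rewrite lef_pV2 ?posrE ?exprn_gt0// ler_eXn2l.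
Qed.

Hypothesis md : is_metric d.

Lemma expansion_gauge_sym x y : expansion_gauge x y = expansion_gauge y x.
Proof.
rewrite /expansion_gauge; congr (sup (_ `|` image _ _)).
by apply/seteqP; split => n /=; rewrite (metric_symm md).
Qed.

Lemma expansion_gauge_xx x : 0 < c -> expansion_gauge x x = 0.
Proof.
move=> c0; apply/eqP; rewrite eq_le expansion_gauge_ge0 andbT.
apply: expansion_gauge_le => // n.
by rewrite (metric_eq0 md _ _).2// ltNge ltW.
Qed.

(** When [x] and [w] are more than [c] apart, one of the three intermediate pairs is at least
    [c / 3] apart. It separates beyond [c] within [m] further steps, a delay that costs a factor
    [a ^+ m <= 2]. *)
Lemma expansion_gauge_trian m : 0 < c -> a ^+ m <= 2 ->
  (forall x y, c / 3 <= d x y ->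
    exists2 k, (k <= m)%N & c < d (iter k f x) (iter k f y)) ->
  forall x y z w, expansion_gauge x w <=
    2 * Num.max (expansion_gauge x y)
          (Num.max (expansion_gauge y z) (expansion_gauge z w)).
Proof.
move=> c0 am dm x y z w; set M := Num.max _ _.
have M0 : 0 <= M by rewrite le_max expansion_gauge_ge0.
apply: expansion_gauge_le => [|n cn]; first by rewrite mulr_ge0.
have le2M u v : c / 3 <= d (iter n f u) (iter n f v) ->
    expansion_gauge u v <= M -> a ^- n <= 2 * M.
  move=> /dm[k km]; rewrite -!iterD => /expansion_gauge_ge guv gM.
  apply: le_trans (ler_wpM2l _ (le_trans guv gM)) => //.
  rewrite exprD invfM mulrA ler_peMl ?invr_ge0 ?exprn_ge0 ?(ltW a0)//.
  rewrite ler_pdivlMr ?exprn_gt0// mul1r (le_trans _ am)//.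
  by rewrite ler_eXn2l.
have := metric_trian md (iter n f x) (iter n f y) (iter n f w).
have := metric_trian md (iter n f y) (iter n f z) (iter n f w).
have [/le2M + _ _|xy] := leP (c / 3) (d (iter n f x) (iter n f y)).
  by apply; rewrite le_max lexx.
have [/le2M + _ _|yz] := leP (c / 3) (d (iter n f y) (iter n f z)).
  by apply; rewrite !le_max lexx orbT.
have [/le2M + _ _|zw] := leP (c / 3) (d (iter n f z) (iter n f w)).
  by apply; rewrite !le_max lexx !orbT.
by move=> *; exfalso; lra.
Qed.

End ExpansionGauge.

Lemma expansive_metric (R : realType) (X : topologicalType) (d : X -> X -> R)
    (f : X -> X) (c : R) :
  compact [set: X] -> compatible_metric d -> continuous f -> 0 < c ->
  (forall x y, (forall n, d (iter n f x) (iter n f y) <= c) -> x = y) ->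
  exists (D : X -> X -> R) (a : R), [/\ compatible_metric D, 1 < a,
    forall x y, D (f x) (f y) <= a * D x y &
    forall n x y, (forall i, (i < n)%N -> d (iter i f x) (iter i f y) <= c) ->
      D x y <= a ^- n].
Proof.
move=> compactX dX contf c0 expf; have md := dX.1.
have c30 : 0 < c / 3 by rewrite divr_gt0.
have [m dm] := expansive_uniform dX compactX contf c30 expf.
(* This is the root of 2 of order [m.+1], which gives [a ^+ m <= 2]; the successor keeps the order
   positive. *)
pose a : R := expR (ln 2 / m.+1%:R).
have a1 : 1 < a by rewrite expR_gt1 divr_gt0// ln_gt0// ltr1n.
have a0 : 0 < a by exact: lt_trans ltr01 a1.
have am : a ^+ m <= 2.
  apply: (@le_trans _ _ (a ^+ m.+1)); first by rewrite ler_eXn2l.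
  by rewrite -expRM_natl mulrCA divff ?pnatr_eq0// mulr1 lnK ?posrE.
pose g := expansion_gauge d f c a.
have g0 := expansion_gauge_ge0 d f c a1 : forall x y, 0 <= g x y.
have gsym := expansion_gauge_sym f c a md : forall x y, g x y = g y x.
have gxx x : g x x = 0 := expansion_gauge_xx f a1 md x c0.
have gtrian := expansion_gauge_trian a1 md c0 am dm.
pose D := chain_metric g.
have gD x y : g x y <= 2 * D x y := le_frink g0 gxx gtrian x y.
have Dbowen n x y : (forall i, (i < n)%N -> d (iter i f x) (iter i f y) <= c) ->
    D x y <= a ^- n.
  move=> xyn; apply: le_trans (expansion_gauge_bowen a1 xyn).
  exact: chain_metric_le.
exists D, a; split => //; last first.
  exact: chain_metric_homo (ltW a0) (expansion_gauge_homo d f c a1).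
split; first split.
- exact: chain_metric_ge0.
- move=> x y; split=> [Dxy|->]; last first.
    apply/eqP; rewrite eq_le chain_metric_ge0// andbT -(gxx y).
    exact: chain_metric_le.
  apply: expf => n; rewrite leNgt; apply/negP => cn.
  have := le_trans (expansion_gauge_ge a1 cn) (gD x y); rewrite Dxy mulr0 leNgt.
  by rewrite invr_gt0 exprn_gt0.
- exact: chain_metric_sym.
- exact: chain_metric_trian.
move=> A; rewrite openE; split=> [oA x Ax|DA x Ax].
- have /(compatible_nbhsP dX)[r r0 rA] := oA x Ax.
  have [k dk] := expansive_uniform dX compactX contf r0 expf.
  (* If [d x y >= r], the orbits separate by time [k], so the gauge is at least [a ^- k] and, by
     Frink's bound, [D x y] is at least half of that. *)
  exists (a ^- k / 2); first by rewrite divr_gt0// invr_gt0 exprn_gt0.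
  move=> y /= Dxy; apply: rA => /=; rewrite ltNge; apply/negP => /dk[j jk cj].
  have := le_trans (expansion_gauge_ge a1 cj) (gD x y).
  rewrite mulrC -ler_pdivrMr// leNgt => /negP; apply.
  apply: (lt_le_trans Dxy); rewrite ler_pM2r//.
  by rewrite lef_pV2 ?posrE ?exprn_gt0// ler_eXn2l.
- have [r r0 rA] := DA x Ax.
  have [n nr] : exists n, a ^- n < r.
    have [n rn] := exprn_unbounded r^-1 a1; exists n.
    by rewrite invf_plt ?posrE ?exprn_gt0.
  (* Conversely, every [D]-ball contains a Bowen ball, which is a neighbourhood because only
     finitely many iterates are constrained. *)
  have near_n k : \forall y \near x,
      forall i, (i < k)%N -> d (iter i f x) (iter i f y) <= c.
    elim: k => [|k IH]; first by apply: nearW.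
    near=> y => i; rewrite ltnS leq_eqVlt => /predU1P[->|].
      apply: ltW; near: y.
      exact: (compatible_nearM dX x (continuous_iter contf) c0).
    by move: i; near: y.
  apply: filterS (near_n n) => y xyn; apply: rA.
  exact: le_lt_trans (Dbowen _ _ _ xyn) nr.
Unshelve. all: by end_near. Qed.

(** * Exponential bounds on itinerary counts *)

Lemma itinerary_cover_count (R : realType) (X : Type) (f : X -> X)
    (U : set (set X)) (A : set X) (b : R) (p M : nat) (O : nat -> set X)
    (B : nat -> nat -> set X) (t : nat -> nat) :
  U A -> 1 <= b ->
  (forall x, exists2 i, (i < p)%N & O i x) ->
  (forall i j, U (B i j)) ->
  (forall i j x, O i x -> (j < t i)%N -> B i j (iter j f x)) ->
  (forall i, (i < p)%N -> (0 < t i <= M)%N) ->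
  \sum_(i < p) b ^- t i <= 1 ->
  forall n, exists2 N, itinerary_cover f U n N & N%:R <= b ^+ (n + M).
Proof.
move=> UA b1 Ocov UB OB tM tsum; have b0 : 0 < b by exact: lt_le_trans ltr01 b1.
(* Points of [O i] need at most [b ^+ (n.+1 + M) * b ^- t i] itineraries of length [n.+1], those of
   the remaining time [n.+1 - t i]; the weights [b ^- t i] sum to at most 1. *)
elim/ltn_ind => -[|n] IH.
  exists 1%N; first exact: itinerary_cover0 UA.
  by rewrite add0n exprn_ege1.
have /choice[c cP] : forall i, exists N, (i < p)%N ->
    itinerary_cover f U (n.+1 - t i) N /\ N%:R <= b ^+ (n.+1 + M) * b ^- t i.
  move=> i; have [ip|] := ltnP i p; last by exists 0%N.
  have /andP[t0 tiM] := tM i ip.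
  have tnM : (t i <= n.+1 + M)%N by rewrite (leq_trans tiM)// leq_addl.
  have bE : b ^+ (n.+1 + M) * b ^- t i = b ^+ (n.+1 + M - t i).
    by rewrite expfB_cond ?unitfE ?gt_eqF.
  have [tn|nt] := leqP (t i) n.+1.
    have [|N covN leN] := IH (n.+1 - t i)%N; first by rewrite ltn_subrL t0.
    exists N => _; split => //.
    by rewrite bE -addnBAC.
  (* If [t i] exceeds the length, nothing remains to be counted; the slack [M >= t i] keeps the
     bound at least 1. *)
  exists 1%N => _; rewrite (eqP (ltnW nt : n.+1 - t i == 0)%N).
  split; first exact: itinerary_cover0 UA.
  by rewrite bE exprn_ege1.
exists (\sum_(i < p) c i)%N.
  by apply: (itinerary_cover_rec Ocov UB OB) => i ip; have [] := cP i ip.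
rewrite natr_sum.
apply: (@le_trans _ _ (\sum_(i < p) b ^+ (n.+1 + M) * b ^- t i)).
  by apply: ler_sum => i _; have [] := cP i (ltn_ord i).
by rewrite -mulr_sumr ler_piMr// exprn_ge0// ltW.
Qed.

(** The factor [C] contributes [ln C / n], which vanishes in the limit. *)
Lemma cover_entropy_le (R : realType) (X : Type) (f : X -> X) (U : set (set X))
    (A : set X) (b C : R) :
  U A -> 1 <= b -> 1 <= C ->
  (forall n, exists2 N, itinerary_cover f U n N & N%:R <= b ^+ n * C) ->
  (cover_entropy R f U <= (ln b)%:E)%E.
Proof.
move=> UA b1 C1 cov.
have b0 : 0 < b by exact: lt_le_trans ltr01 b1.
have C0 : 0 < C by exact: lt_le_trans ltr01 C1.
have [||N [h _ [-> cvgh _ minN]]] := @cover_entropy_cvg R X f U.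
- by have [M] := cov 1%N; exists M.
- by exists A.
rewrite lee_fin; apply/ler_addgt0Pr => e e0.
apply: (cvgr_to_le cvgh); near=> n.
have n0 : 0 < n%:R :> R by rewrite ltr0n; near: n; exact: nbhs_infty_gt.
rewrite ler_pdivrMl//; have [M covM leM] := cov n.
have : ln (maxn 1 (N n))%:R <= ln (b ^+ n * C) :> R.
  rewrite ler_ln ?posrE ?ltr0n ?leq_max// ?mulr_gt0 ?exprn_gt0//.
  rewrite natr_max ge_max mulr_ege1 ?exprn_ege1//=.
  by rewrite (le_trans _ leM)// ler_nat minN.
rewrite lnM ?posrE ?exprn_gt0// lnXn// => /le_trans; apply.
rewrite mulrDr mulr_natl lerD2l -ler_pdivrMr//; near: n.
exact: nbhs_infty_ger.
Unshelve. all: by end_near. Qed.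

Lemma cover_entropy_empty (R : realType) (X : Type) (f : X -> X)
    (U : set (set X)) : (forall x : X, False) -> cover_entropy R f U = 0%E.
Proof.
move=> X0; rewrite /cover_entropy.
rewrite (_ : (fun n => _) = fun=> 0%E); first exact: lim_cst.
apply/funext => n; rewrite (_ : cover_number _ _ = 0%:R%:E).
  by rewrite logp_nat ln1 mule0.
apply/eqP; rewrite eq_le (cover_number_le R (itinerary_cover_empty f U n X0)).
by apply: le_ereal_inf_tmp => _ [k _ <-]; rewrite lee_fin ler_nat.
Qed.

(** * Covers from vanishing Hausdorff measure, and their expansion times *)

Lemma hausdorff_measure0_cover (R : realType) (X : Type) (d : X -> X -> R)
    (s delta eta : R) :
  hausdorff_measure d s = 0%E -> 0 < delta -> 0 < eta ->
  exists E : nat -> set X, [/\ cover setT E = setT,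
    forall i, (diam d (E i) <= delta%:E)%E &
    (\sum_(i <oo) diam_pow d s (E i) < eta%:E)%E].
Proof.
move=> Hs delta0 eta0.
have : (hausdorff_pre d s delta < eta%:E)%E.
  apply: (@le_lt_trans _ _ 0%E); last by rewrite lte_fin.
  by rewrite -Hs; apply: ereal_sup_ubound; exists delta.
by move=> /ereal_inf_lt[_ [E [Ecov Edelta] <-] Eeta]; exists E.
Qed.

Lemma diam_pow_ge0 (R : realType) (X : Type) (d : X -> X -> R) (s : R) A :
  (0 <= diam_pow d s A)%E.
Proof. by rewrite /diam_pow; case: ifP => // _; exact: poweR_ge0. Qed.

(** At exponent 0 every nonempty set contributes 1, so a cover of total below 1 has no nonempty
    member. This rules out [s = 0] in the entropy bound. *)
Lemma hausdorff_measure0_empty (R : realType) (X : Type) (d : X -> X -> R) :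
  hausdorff_measure d 0 = 0%E -> forall x : X, False.
Proof.
move=> H0 x.
have [E [Ecov _]] := hausdorff_measure0_cover H0 (@ltr01 R) (@ltr01 R).
have : cover setT E x by rewrite Ecov.
move=> [i _ Eix]; apply/negP; rewrite -leNgt.
rewrite (nneseriesD1 (n := i))//; last by move=> k _; exact: diam_pow_ge0.
rewrite {1}/diam_pow ifF ?poweRe0; last first.
  by apply/eqP => Ei; rewrite Ei in Eix.
by rewrite leeDl// nneseries_ge0// => k _ _; exact: diam_pow_ge0.
Qed.

(** Starting at exponent 2 keeps the padding within half of the total weight 1. *)
Lemma sum_half_geometric (R : realType) p :
  \sum_(i < p) (2 : R) ^- i.+2 <= 2^-1.
Proof.
suff -> : \sum_(i < p) (2 : R) ^- i.+2 = 2^-1 - 2 ^- p.+1.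
  by rewrite gerBl invr_ge0 exprn_ge0.
elim: p => [|p IH]; first by rewrite big_ord0 expr1 subrr.
rewrite big_ord_recr IH /= [in RHS]exprS (exprS _ p.+1).
by field; rewrite expf_neq0.
Qed.

(** [t] is the last time before [lam ^+ n * e] exceeds [delta]; [lam * e <= delta] makes it
    positive. *)
Lemma expansion_time (R : realType) (lam delta e : R) :
  1 < lam -> 0 < e -> lam * e <= delta ->
  exists t, [/\ (0 < t)%N, lam ^+ t * e <= delta & delta < lam ^+ t.+1 * e].
Proof.
move=> lam1 e0 led.
have exP : exists n, delta < lam ^+ n * e.
  have [n nP] := exprn_unbounded (delta / e) lam1.
  by exists n; rewrite -ltr_pdivrMr.
case: (ex_minnP exP) => -[|[|n]] nP nmin.
- have : e <= lam * e by rewrite ler_peMl ?ltW.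
  by rewrite mul1r in nP => /(lt_le_trans nP)/lt_le_trans/(_ led); rewrite ltxx.
- by move: nP; rewrite expr1 ltNge led.
- exists n.+1; split => //; rewrite leNgt; apply/negP => /nmin.
  by rewrite ltnn.
Qed.

Lemma diam_ub (R : realType) (X : Type) (d : X -> X -> R) (E : set X) x y :
  E x -> E y -> ((d x y)%:E <= diam d E)%E.
Proof. by move=> Ex Ey; apply: ereal_sup_ubound; exists x => //; exists y. Qed.

(* The summand [2 ^- i.+2] absorbs the sets of diameter 0, which stay small
   forever. *)
Lemma hausdorff_expansion_times (R : realType) (X : Type) (d : X -> X -> R)
    (lam delta s : R) (E : nat -> set X) :
  is_metric d -> 1 < lam -> 0 < delta -> 0 < s ->
  (forall i, (diam d (E i) <= (delta / lam)%:E)%E) ->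
  forall i, exists t, [/\ (0 < t)%N,
    forall x y, E i x -> E i y -> lam ^+ t * d x y <= delta &
    (((lam `^ s) ^- t)%:E <= ((lam / delta) `^ s)%:E * diam_pow d s (E i)
       + (2 ^- i.+2)%:E)%E].
Proof.
move=> md lam1 delta0 s0 Ed i.
have lam0 : 0 < lam by exact: lt_trans ltr01 lam1.
have b1 : 1 < lam `^ s.
  have -> : 1 = 1 `^ s :> R by rewrite powR1.
  by rewrite gt0_ltr_powR// nnegrE ltW.
have b0 : 0 < lam `^ s by exact: lt_trans ltr01 b1.
have K0 : (0 <= ((lam / delta) `^ s)%:E)%E by rewrite lee_fin powR_ge0.
(* A set of diameter 0, or an empty one, admits every time, so [t] is taken large enough for the
   padding term alone to dominate. *)
have [Ei0|Eine] := pselect (forall x y, E i x -> E i y -> d x y = 0).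
  have [t tP] := exprn_unbounded (2 ^+ i.+2) b1.
  have t0 : (0 < t)%N.
    by case: t tP => //; rewrite expr0 ltNge exprn_ege1// ler1n.
  exists t; split => //.
    by move=> x y Ex Ey; rewrite Ei0// mulr0 ltW.
  apply: (@le_trans _ _ (2 ^- i.+2)%:E); last first.
    by rewrite leeDr// mule_ge0// diam_pow_ge0.
  by rewrite lee_fin lef_pV2 ?posrE ?exprn_gt0// ltW.
have [x [y [Ex Ey dxy]]] : exists x y, [/\ E i x, E i y & 0 < d x y].
  apply: contrapT => nxy; apply: Eine => x y Ex Ey.
  apply/eqP; rewrite eq_le (metric_ge0 md) andbT leNgt; apply/negP => dxy.
  by apply: nxy; exists x, y.
have eE : diam d (E i) = (fine (diam d (E i)))%:E.
  rewrite fineK// fin_numElt (lt_le_trans _ (diam_ub d Ex Ey)) ?ltNyr//=.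
  by rewrite (le_lt_trans (Ed i)) ?ltry.
set e := fine _ in eE.
have e0 : 0 < e.
  by rewrite -lte_fin -eE (lt_le_trans _ (diam_ub d Ex Ey))// lte_fin.
have led : lam * e <= delta.
  by rewrite mulrC -ler_pdivlMr// -lee_fin -eE.
have [t [t0 lt gt]] := expansion_time lam1 e0 led.
exists t; split => //.
  move=> u v Eu Ev; apply: le_trans lt.
  rewrite ler_wpM2l ?exprn_ge0 ?(ltW lam0)//.
  by rewrite -lee_fin -eE; exact: diam_ub.
rewrite /diam_pow ifF; last by apply/eqP => E0; rewrite E0 in Ex.
rewrite eE poweR_EFin -EFinM -EFinD lee_fin.
(* Maximality of [t] reads [lam ^- t < lam / delta * e]; raising this to the power [s] gives the
   bound. *)
apply: (@le_trans _ _ ((lam / delta * e) `^ s)); last first.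
  rewrite powRM ?(ltW e0) ?divr_ge0 ?(ltW lam0) ?(ltW delta0)//.
  by rewrite lerDl invr_ge0 exprn_ge0.
have -> : (lam `^ s) ^- t = (lam ^- t) `^ s.
  rewrite -(powR_invn t (powR_ge0 lam s)) -(powR_invn t (ltW lam0)).
  by rewrite -powRrM mulrC powRrM.
apply: ge0_ler_powR; rewrite ?nnegrE ?ltW//.
- by rewrite invr_gt0 exprn_gt0.
- by rewrite mulr_gt0 ?divr_gt0.
by rewrite mulrAC ltr_pdivlMr// ltr_pdivrMl ?exprn_gt0// mulrA -exprSr.
Qed.

(** * Entropy bounded by a Hausdorff exponent and a Lipschitz constant *)

Section EntropyUpperBound.
Context {R : realType} {X : topologicalType} (d : X -> X -> R) (f : X -> X).
Hypothesis dX : compatible_metric d.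
Hypothesis compactX : compact [set: X].

Lemma lipschitz_iter (lam : R) n j x y : 1 <= lam ->
  (forall x y, d (f x) (f y) <= lam * d x y) -> (j <= n)%N ->
  d (iter j f x) (iter j f y) <= lam ^+ n * d x y.
Proof.
move=> lam1 flam jn; have lam0 : 0 <= lam by exact: le_trans ler01 lam1.
apply: (@le_trans _ _ (lam ^+ j * d x y)); last first.
  by rewrite ler_wpM2r ?(metric_ge0 dX.1)// ler_weXn2l.
elim: j {jn} => [|j IH]; first by rewrite mul1r.
by rewrite !iterS exprS -mulrA (le_trans (flam _ _))// ler_wpM2l.
Qed.

Lemma cover_entropy_le_hausdorff (U : set (set X)) (lam s : R) :
  open_cover U -> 1 < lam -> (forall x y, d (f x) (f y) <= lam * d x y) ->
  0 <= s -> hausdorff_measure d s = 0%E ->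
  (cover_entropy R f U <= (s * ln lam)%:E)%E.
Proof.
move=> Ucov lam1 flam s0 Hs; have md := dX.1.
have lam0 : 0 < lam by exact: lt_trans ltr01 lam1.
have [X0|] := pselect (forall x : X, False).
  by rewrite cover_entropy_empty// lee_fin mulr_ge0// ln_ge0// ltW.
move=> /existsNP[x0 _].
have [r r0 rU] := lebesgue_number dX compactX Ucov.
have [A0 UA0 _] := rU x0.
have {}s0 : 0 < s.
  move: s0; rewrite le_eqVlt => /predU1P[s0|//]; exfalso.
  by rewrite -s0 in Hs; exact: hausdorff_measure0_empty Hs x0.
(* Orbits will drift by at most [delta] within [E i] and by less than [delta] through its
   enlargement, together less than the Lebesgue number [r]. *)
pose delta := r / 3.
have delta0 : 0 < delta by rewrite divr_gt0.
pose K := (lam / delta) `^ s.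
have K0 : 0 < K by rewrite powR_gt0// divr_gt0.
(* The bound [(2 * K)^-1] leaves weight one half for the padding; diameters up to [delta / lam]
   ensure positive expansion times. *)
have [|| E [Ecov Ediam Esum]] :=
    @hausdorff_measure0_cover R X d s (delta / lam) (2 * K)^-1 Hs.
- by rewrite divr_gt0.
- by rewrite invr_gt0 mulr_gt0.
have /choice[t tP] := hausdorff_expansion_times md lam1 delta0 s0 Ediam.
(* The [E i] need not be open; enlarging them by a radius that [t i] steps expand to at most [delta]
   lets compactness select finitely many. *)
pose O i := [set x | exists2 y, E i y & d y x < delta * lam ^- t i].
have [p Ocov] : exists p, forall x, exists2 i, (i < p)%N & O i x.
  pose P p x := exists2 i, (i < p)%N & O i x.
  have /compact_near_coveringP/(_ nat \oo P) := compactX.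
  move=> /(_ _)[x _|p _ pP]; last by exists p => x; exact: pP p (leqnn p) x I.
  have : cover setT E x by rewrite Ecov.
  move=> [i _ Eix].
  have rad0 : 0 < delta * lam ^- t i by rewrite mulr_gt0// invr_gt0 exprn_gt0.
  near=> y p; exists i => /=.
    by near: p; exact: nbhs_infty_gt.
  by exists x => //; near: y; exact: (compatible_near dX x rad0).
have /choice[B BP] : forall i, exists B : nat -> set X, (forall j, U (B j)) /\
    forall j x, O i x -> (j < t i)%N -> B j (iter j f x).
  move=> i; have [[y0 Ey0]|nE] := pselect (exists y, E i y); last first.
    by exists (fun=> A0); split => // j x [y Ey]; exfalso; apply: nE; exists y.
  (* The orbit of one point [y0] of [E i] chooses the sets visited: all of [O i] stays within [r] of
     it before time [t i]. *)
  have /choice[B BP] : forall j, exists B, U B /\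
      [set y | d (iter j f y0) y < r] `<=` B.
    by move=> j; have [B UB rB] := rU (iter j f y0); exists B.
  exists B; split=> [j|j x [y Ey yx] jt]; first by have [] := BP j.
  have [_] := BP j; apply => /=; have [_ tE _] := tP i.
  have ltn0 : 0 < lam ^+ t i by rewrite exprn_gt0.
  have l1 := lipschitz_iter y0 x (ltW lam1) flam (ltnW jt).
  have l2 : lam ^+ t i * d y0 x <= lam ^+ t i * d y0 y + lam ^+ t i * d y x.
    by rewrite -mulrDr ler_wpM2l ?(ltW ltn0)// (metric_trian md).
  have l3 : lam ^+ t i * d y x < delta by rewrite mulrC -ltr_pdivlMr.
  have l4 := tE _ _ Ey0 Ey.
  have : delta + delta < r by rewrite /delta; lra.
  lra.
have b1 : 1 <= lam `^ s.
  have -> : 1 = 1 `^ s :> R by rewrite powR1.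
  by apply: ge0_ler_powR; rewrite ?nnegrE ?ltW.
have tsum : \sum_(i < p) (lam `^ s) ^- t i <= 1.
  rewrite -lee_fin -sumEFin.
  apply: (@le_trans _ _ (\sum_(i < p) (K%:E * diam_pow d s (E i)
      + (2 ^- i.+2)%:E))%E).
    by apply: lee_sum => i _; have [] := tP i.
  rewrite big_split /= -ge0_sume_distrr => [|i _]; last exact: diam_pow_ge0.
  rewrite sumEFin [X in (_ <= X%:E)%E]splitr EFinD leeD//; last first.
    by rewrite lee_fin mul1r; exact: sum_half_geometric.
  apply: (@le_trans _ _ (K%:E * ((2 * K)^-1)%:E)%E); last first.
    by rewrite -EFinM lee_fin invfM mulrCA divff ?gt_eqF// mulr1 mul1r.
  rewrite lee_pmul2l//; apply: le_trans (ltW Esum).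
  rewrite -(big_mkord xpredT (fun i => diam_pow d s (E i))).
  by apply: nneseries_lim_ge => i _ _; exact: diam_pow_ge0.
pose M := (\max_(i < p) t i)%N.
have tM i : (i < p)%N -> (0 < t i <= M)%N.
  move=> ip; have [-> _ _] := tP i.
  exact: (@leq_bigmax _ (fun i : 'I_p => t i) (Ordinal ip)).
rewrite -ln_powR.
apply: (@cover_entropy_le _ _ _ _ A0 _ ((lam `^ s) ^+ M)) => //.
  exact: exprn_ege1.
move=> n; have UB i j : U (B i j) by have [+ _] := BP i; apply.
have OB i j x : O i x -> (j < t i)%N -> B i j (iter j f x).
  by have [_ +] := BP i; apply.
have [N covN leN] := itinerary_cover_count UA0 b1 Ocov UB OB tM tsum n.
by exists N => //; rewrite -exprD.
Unshelve. all: by end_near. Qed.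

End EntropyUpperBound.

(** * Hausdorff dimension bounded by the entropy of a cover *)

Section HausdorffUpperBound.
Context {R : realType} {X : Type} (D : X -> X -> R) (f : X -> X)
  (U : set (set X)) (a : R).
Hypothesis mD : is_metric D.
Hypothesis a1 : 1 < a.
Hypothesis DU : forall n (A : nat -> set X), (forall k, U (A k)) -> forall x y,
  (forall k, (k < n)%N -> A k (iter k f x) /\ A k (iter k f y)) ->
  D x y <= a ^- n.

Let a0 : 0 < a. Proof. exact: lt_trans ltr01 a1. Qed.

Lemma diam_ge0 (E : set X) : E !=set0 -> (0 <= diam D E)%E.
Proof.
move=> [x Ex]; have := diam_ub D Ex Ex.
by rewrite (metric_eq0 mD x x).2.
Qed.

(** The points sharing one of the [N] itineraries form a set of diameter at most [a ^- n]; empty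
    sets, which cost nothing, complete the sequence. *)
Lemma itinerary_hausdorff_pre n N s : 0 <= s -> itinerary_cover f U n N ->
  (hausdorff_pre D s (a ^- n) <= (N%:R * (a ^- n) `^ s)%:E)%E.
Proof.
move=> s0 [I [B [cI UB Bcov]]].
pose E i := if insub i is Some k then
  [set x | forall l, (l < n)%N -> B (enum_val (k : 'I_#|I|)) l (iter l f x)]
  else set0.
have an0 : 0 <= a ^- n by rewrite invr_ge0 exprn_ge0// ltW.
have Ediam i : (diam D (E i) <= (a ^- n)%:E)%E.
  apply: ge_ereal_sup => _ [x Ex [y Ey <-]]; rewrite lee_fin.
  move: Ex Ey; rewrite /E; case: insubP => // k _ _ xE yE.
  by apply: (DU (UB (enum_val k))) => l ln; split; [exact: xE|exact: yE].
apply: (@le_trans _ _ (\sum_(i <oo) diam_pow D s (E i))%E).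
  apply: ereal_inf_lbound; exists E => //; split => //.
  apply/seteqP; split => // x _; have [j jP] := Bcov x.
  by exists (enum_rank j) => //; rewrite /E valK enum_rankK.
rewrite (nneseries_split 0 N); last by move=> k _; exact: diam_pow_ge0.
rewrite [X in (_ + X)%E]eseries0 ?adde0; last first.
  move=> i Ni _; rewrite /diam_pow /E insubF ?eqxx//.
  by rewrite cI; apply/negbTE; rewrite -leqNgt.
apply: (@le_trans _ _ (\sum_(0 <= i < 0 + N) ((a ^- n) `^ s)%:E)%E).
  apply: lee_sum => i _; rewrite /diam_pow; case: ifPn => [_|/set0P E0].
    by rewrite lee_fin powR_ge0.
  rewrite -poweR_EFin; apply: gt0_ler_poweR => //.
    by rewrite in_itv/= leey diam_ge0.
  by rewrite in_itv/= leey lee_fin an0.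
by rewrite sumEFin sumr_const_nat subn0 lee_fin mulr_natl.
Qed.

Lemma hausdorff_pre_ge0 s delta : (0 <= hausdorff_pre D s delta)%E.
Proof.
apply: le_ereal_inf_tmp => _ [E _ <-].
by apply: nneseries_ge0 => i _ _; exact: diam_pow_ge0.
Qed.

Lemma hausdorff_preS s delta delta' : delta <= delta' ->
  (hausdorff_pre D s delta' <= hausdorff_pre D s delta)%E.
Proof.
move=> dd; apply: le_ereal_inf_tmp => _ [E [Ecov Ed] <-].
apply: ereal_inf_lbound; exists E => //; split => // i.
by rewrite (le_trans (Ed i))// lee_fin.
Qed.

(** For every exponent above [h / ln a], the total cost of the itinerary covers tends to 0 as their
    length grows. *)
Lemma hausdorff_dim_le_entropy h : (exists A, U A) ->
  (exists N, itinerary_cover f U 1 N) -> cover_entropy R f U = h%:E ->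
  (hausdorff_dim D <= (h / ln a)%:E)%E.
Proof.
move=> UA cov1 hE; have lna : 0 < ln a by rewrite ln_gt0.
have [N [h' covN [h'E cvgh h0 _]]] := @cover_entropy_cvg R X f U cov1 UA.
have {h'E}hh' : h' = h by move: h'E; rewrite hE => -[].
rewrite {h'}hh' in cvgh h0.
apply/lee_addgt0Pr => e e0; rewrite -EFinD; set s := h / ln a + e.
have s0 : 0 <= s by rewrite addr_ge0 ?divr_ge0// ltW.
suff H0 : hausdorff_measure D s = 0%E by apply: ereal_inf_lbound; exists s.
apply/eqP; rewrite eq_le; apply/andP; split; last first.
  apply: (le_trans (hausdorff_pre_ge0 s 1)); apply: ereal_sup_ubound.
  by exists 1 => //=; exact: ltr01.
apply: ge_ereal_sup => _ [delta /= delta0 <-].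
apply/lee_addgt0Pr => eta eta0; rewrite add0e.
(* Half of the slack in the exponent absorbs the error in the growth rate of [N n]; the other half
   leaves the decay [expR (- q) ^+ n]. *)
pose q := e * ln a / 2.
have q0 : 0 < q by rewrite divr_gt0 ?mulr_gt0.
have sE : s * ln a = h + q + q.
  by rewrite mulrDl divfK ?gt_eqF// -addrA -splitr.
near \oo => n.
have n0 : 0 < n%:R :> R by rewrite ltr0n; near: n; exact: nbhs_infty_gt.
have an : a ^- n <= delta.
  near: n; have /cvgr0_norm_le/(_ _ delta0) : (a^-1 ^+ n @[n --> \oo] --> 0).
    by apply: cvg_expr; rewrite gtr0_norm ?invr_gt0// invf_lt1.
  by apply: filterS => n; rewrite exprVn; apply: le_trans; exact: ler_norm.
have Nn : (N n)%:R <= expR (n%:R * (h + q)).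
  have Nmax : (N n)%:R <= (maxn 1 (N n))%:R :> R by rewrite ler_nat leq_maxr.
  apply: (le_trans Nmax); rewrite -[leLHS]lnK ?posrE ?ltr0n ?leq_max//.
  rewrite ler_expR -ler_pdivrMl//; near: n.
  by apply: (cvgr_le _ cvgh); rewrite ltrDl.
have qn : expR (- q) ^+ n <= eta.
  near: n; have : expR (- q) ^+ n @[n --> \oo] --> 0.
    by apply: cvg_expr; rewrite gtr0_norm ?expR_gt0// expR_lt1 oppr_lt0.
  move=> /cvgr0_norm_le/(_ _ eta0).
  by apply: filterS => n; apply: le_trans; exact: ler_norm.
apply: (le_trans (hausdorff_preS s an)).
apply: (le_trans (itinerary_hausdorff_pre s0 (covN n))).
rewrite lee_fin; apply: le_trans qn.
have -> : (a ^- n) `^ s = expR (- (n%:R * (s * ln a))).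
  rewrite /powR gt_eqF ?invr_gt0 ?exprn_gt0// lnV ?posrE ?exprn_gt0// lnXn//.
  by congr expR; rewrite -mulr_natl; ring.
apply: (le_trans (ler_wpM2r (expR_ge0 _) Nn)).
by rewrite -expRD -expRM_natl ler_expR sE; lra.
Unshelve. all: by end_near. Qed.

End HausdorffUpperBound.

(** * The two inequalities and the theorem *)

Lemma entropy_le_HD_logLip (R : realType) (X : topologicalType)
    (d : X -> X -> R) (f : X -> X) :
  compact [set: X] -> compatible_metric d ->
  (topological_entropy R f <= HD_logLip d f)%E.
Proof.
move=> compactX dX; have md := dX.1; rewrite /HD_logLip /mule_infty.
case: ifPn => [_|]; first by rewrite leey.
rewrite negb_or => /andP[HDoo lipoo].
have HD0 : (0 <= hausdorff_dim d)%E.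
  by apply: le_ereal_inf_tmp => _ [s [s0 _] <-]; rewrite lee_fin.
have lip0 : (0 <= logp (Lip d f))%E by rewrite /logp le_max lexx orbT.
have HDE : hausdorff_dim d = (fine (hausdorff_dim d))%:E.
  by rewrite fineK// ge0_fin_numE// lt_neqAle HDoo leey.
have lipE : logp (Lip d f) = (fine (logp (Lip d f)))%:E.
  by rewrite fineK// ge0_fin_numE// lt_neqAle lipoo leey.
set H := fine _ in HDE; set l := fine _ in lipE.
have H0 : 0 <= H by rewrite -lee_fin -HDE.
have l0 : 0 <= l by rewrite -lee_fin -lipE.
have Lipl : (Lip d f <= (expR l)%:E)%E.
  have : (lne (Lip d f) <= l%:E)%E by rewrite -lipE /logp le_max lexx.
  case: (Lip d f) => [v||] //=; last by move=> _; rewrite leNye.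
  case: ifPn => [v0 _|]; first by rewrite lee_fin (le_trans v0)// expR_ge0.
  by rewrite -ltNge => v0; rewrite !lee_fin -ler_expR lnK.
have flip x y : d (f x) (f y) <= expR l * d x y.
  have [dxy|] := ltP 0 (d x y).
    rewrite -ler_pdivrMr// -lee_fin; apply: le_trans Lipl.
    by apply: ereal_sup_ubound; right; exists (x, y).
  rewrite le_eqVlt ltNge (metric_ge0 md) orbF => /eqP/(metric_eq0 md) ->.
  rewrite (metric_eq0 md _ _).2// mulr_ge0 ?expR_ge0//.
  exact: (metric_ge0 md).
rewrite HDE lipE -EFinM; apply: ge_ereal_sup => _ [U Ucov <-].
apply/lee_addgt0Pr => e e0.
have c0 : 0 < H + l + 1 by rewrite ltr_wpDl// addr_ge0.
(* With [u <= 1], the product [(H + u) * (l + u)] exceeds [H * l] by at most [u * (H + l + 1) <= e];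
   [u > 0] makes the Lipschitz bound [expR (l + u)] strictly larger than 1. *)
pose u := Num.min 1 (e / (H + l + 1)).
have u0 : 0 < u by rewrite lt_min ltr01 divr_gt0.
have u1 : u <= 1 by rewrite ge_min lexx.
have ue : u * (H + l + 1) <= e by rewrite -ler_pdivlMr// ge_min lexx orbT.
have : (hausdorff_dim d < (H + u)%:E)%E by rewrite HDE lte_fin ltrDl.
move=> /ereal_inf_lt[_ [s [s0 Hs] <-]]; rewrite lte_fin => sH.
have lam1 : 1 < expR (l + u) by rewrite expR_gt1 ltr_wpDl.
have flam x y : d (f x) (f y) <= expR (l + u) * d x y.
  apply: (le_trans (flip x y)); rewrite ler_wpM2r ?(metric_ge0 md)//.
  by rewrite ler_expR lerDl ltW.
apply: (le_trans (cover_entropy_le_hausdorff dX compactX Ucov lam1 flam s0 Hs)).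
rewrite -EFinD lee_fin expRK.
have lu0 : 0 <= l + u by rewrite addr_ge0// ltW.
apply: (le_trans (ler_wpM2r lu0 (ltW sH))).
have : u * u <= u * 1 by rewrite ler_wpM2l// ltW.
lra.
Qed.

(** A single metric realises the infimum: the dimension bound [h / ln a] and the Lipschitz bound [a]
    multiply to [h], the entropy of one cover. *)
Lemma HD_logLip_le_entropy (R : realType) (X : topologicalType) (f : X -> X) :
  compact [set: X] -> continuous f -> positively_expansive R f ->
  exists (D : X -> X -> R) (h : R), [/\ compatible_metric D,
    (HD_logLip D f <= h%:E)%E & (h%:E <= topological_entropy R f)%E].
Proof.
move=> compactX contf [d dX [c c0 expf]]; have md := dX.1.
have [D [a [DX a1 flip Dbowen]]] := expansive_metric compactX dX contf c0 expf.
have mD := DX.1.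
have a0 : 0 < a by exact: lt_trans ltr01 a1.
have lna : 0 < ln a by rewrite ln_gt0.
have c20 : 0 < c / 2 by rewrite divr_gt0.
(* Radius [c / 2] puts two points of a member within [c] of each other; [set0] keeps [U] nonempty
   when [X] is empty. *)
pose U : set (set X) := [set set0] `|` range (fun x => [set y | d x y < c / 2]).
have Uopen : open_cover U.
  split.
    move=> _ [->|[x _ <-]]; first exact: open0.
    apply/(dX.2 _) => y /= xy.
    exists (c / 2 - d x y); first by rewrite subr_gt0.
    move=> z /= yz; rewrite (le_lt_trans (metric_trian md x y z))//.
    by rewrite -ltrBrDl.
  apply/seteqP; split => // x _; exists [set y | d x y < c / 2].
    by right; exists x.
  by rewrite /= (metric_eq0 md x x).2.
have UA : exists A, U A by exists set0; left.
have cov1 := finite_itinerary_cover dX compactX f Uopen.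
have [_ [h _ [hE _ h0 _]]] := @cover_entropy_cvg R X f U cov1 UA.
have DU n (A : nat -> set X) : (forall k, U (A k)) -> forall x y,
    (forall k, (k < n)%N -> A k (iter k f x) /\ A k (iter k f y)) ->
    D x y <= a ^- n.
  move=> UAk x y xyA; apply: Dbowen => k /xyA[].
  have [->//|[z _ <-]] /= := UAk k; move=> zx zy.
  have := metric_trian md (iter k f x) z (iter k f y).
  rewrite (metric_symm md _ z); lra.
have HDle := hausdorff_dim_le_entropy mD a1 DU UA cov1 hE.
have HD0 : (0 <= hausdorff_dim D)%E.
  by apply: le_ereal_inf_tmp => _ [s [s0 _] <-]; rewrite lee_fin.
have Liple : (Lip D f <= a%:E)%E.
  apply: ge_ereal_sup => _ [->|[[x y] /= xy <-]]; first by rewrite lee_fin ltW.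
  by rewrite lee_fin ler_pdivrMr.
have Lip0 : (0 <= Lip D f)%E by apply: ereal_sup_ubound; left.
have logple : (logp (Lip D f) <= (ln a)%:E)%E.
  rewrite /logp ge_max lee_fin (ltW lna) andbT -lne_EFin//.
  by rewrite lee_lne// in_itv/= leey ?Lip0// lee_fin ltW.
exists D, h; split => //; last first.
  by rewrite -hE; apply: ereal_sup_ubound; exists U.
rewrite /HD_logLip /mule_infty ifF; last first.
  apply/negbTE; rewrite negb_or -!ltey (le_lt_trans HDle) ?ltry//=.
  by rewrite (le_lt_trans logple) ?ltry.
have -> : h%:E = ((h / ln a)%:E * (ln a)%:E)%E.
  by rewrite -EFinM divfK// gt_eqF.
by apply: lee_pmul => //; rewrite /logp le_max lexx orbT.
Qed.

Theorem theorem5 (R : realType) (X : topologicalType) (f : X -> X)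
    (compactX : compact [set: X]) (metrizableX : metrizable R X)
    (contf : continuous f) (expf : positively_expansive R f) :
  HausLip R f = topological_entropy R f /\
  forall eps : R, 0 < eps ->
    exists2 d : X -> X -> R, compatible_metric d &
      (HD_logLip d f < topological_entropy R f + eps%:E)%E.
Proof.
have [D [h [DX Dh hle]]] := HD_logLip_le_entropy compactX contf expf.
split=> [|eps eps0].
  apply/eqP; rewrite eq_le; apply/andP; split.
    apply: le_trans (le_trans Dh hle).
    by apply: ereal_inf_lbound; exists D.
  by apply: le_ereal_inf_tmp => _ [d dX <-]; exact: entropy_le_HD_logLip.
exists D => //; apply: (le_lt_trans Dh).
by apply: (@lt_le_trans _ _ (h + eps)%:E);
  rewrite ?lte_fin ?ltrDl// EFinD leeD2r.
Qed.
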